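(* Let $G$ be an undirected loop-free graph on $n\ge2$ vertices, let $A(G)$ be its adjacency matrix, and let $\lambda_1(A(G))$ be the smallest eigenvalue of $A(G)$. Then $$\lambda_1(A(G))\ \ge\ -\sqrt{\Delta(G)\,\Delta^2(G)},\qquad \lambda_1(A(G))\ \ge\ -\frac n2,$$ $$\lambda_1(A(G))\ \ge\ -1-\sqrt{(n-1-\delta(G))(n-1-\delta^2(G))}.$$
   Context: The adjacency matrix $A(G)$ of a graph with vertex set $\{1,\dots,n\}$ is the $n\times n$ matrix with $A(G)_{ij}=1$ if $i$ and $j$ are adjacent and $0$ otherwise (so the diagonal is zero). The degree of a vertex is the number of vertices adjacent to it. $\Delta(G)$ and $\delta(G)$ denote the largest and smallest degrees of $G$; $\Delta^2(G)$ and $\delta^2(G)$ denote the second largest and second smallest degrees of $G$ (superscript, not a square), i.e. the second and the second-to-last terms when the degrees of all $n$ vertices are listed with multiplicity in nonincreasing order. *)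

(* Defs.v *)
From HB Require Import structures.
From mathcomp Require Import all_boot all_order all_algebra.
From mathcomp Require Import polyrcf complex.

Set Implicit Arguments.
Unset Strict Implicit.
Unset Printing Implicit Defensive.

Import Order.TTheory GRing.Theory Num.Theory.

Local Open Scope ring_scope.

Definition adjmx (R : pzSemiRingType) (n : nat) (e : rel 'I_n) : 'M[R]_n :=
  \matrix_(i, j) (e i j)%:R.

Definition degree (n : nat) (e : rel 'I_n) (i : 'I_n) : nat :=
  #|[set j | e i j]|.

Definition degree_seq (n : nat) (e : rel 'I_n) : seq nat :=
  sort geq [seq degree e i | i <- enum 'I_n].

(* [max_degree2] and [min_degree2] are the second largest and second smallest
   degrees counted with multiplicity; the default value 0 of [nth] is never
   reached when 2 <= n. *)
Definition max_degree (n : nat) (e : rel 'I_n) : nat := nth 0%N (degree_seq e) 0.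
Definition max_degree2 (n : nat) (e : rel 'I_n) : nat := nth 0%N (degree_seq e) 1.
Definition min_degree (n : nat) (e : rel 'I_n) : nat :=
  nth 0%N (degree_seq e) (n - 1).
Definition min_degree2 (n : nat) (e : rel 'I_n) : nat :=
  nth 0%N (degree_seq e) (n - 2).

Definition is_smallest_eigenvalue (R : realFieldType) (n : nat) (A : 'M[R]_n)
  (l : R) : Prop :=
  eigenvalue A l /\ (forall a : R, eigenvalue A a -> l <= a).

(* [is_smallest_eigenvalue] determines a unique value for every adjacency
   matrix of a nonempty graph: see [smallest_eigenvalue_unique] and
   [adjmx_smallest_eigenvalue_exists]. *)
Lemma smallest_eigenvalue_unique (R : realFieldType) (n : nat) (A : 'M[R]_n)
    (l m : R) :
  is_smallest_eigenvalue A l -> is_smallest_eigenvalue A m -> l = m.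
Proof.
move=> [El Ml] [Em Mm]; apply/eqP.
by rewrite eq_le Ml // Mm.
Qed.

Lemma symmetric_eigenvalue_exists (R : rcfType) (n : nat) (A : 'M[R]_n) :
  (0 < n)%N -> A^T = A -> exists a : R, eigenvalue A a.
Proof.
move=> n0 symA.
pose toC := real_complex R; pose cj := @conjc R; pose B := map_mx toC A.
have [z] : exists z, root (char_poly B) z.
  by apply/closed_rootP; rewrite size_char_poly eqSS -lt0n.
rewrite -eigenvalue_root_char => Bz.
have [v vB v0] := eigenvalueP Bz.
pose w := map_mx cj v.
have cjB : map_mx cj B = B.
  by apply/matrixP => i j; rewrite !mxE; apply: conjc_real.
have symB : B^T = B by rewrite /B -{2}symA; apply/matrixP => i j; rewrite !mxE.
have wB : w *m B = cj z *: w.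
  by rewrite -{1}cjB -map_mxM vB map_mxZ.
have e1 : v *m B *m w^T = cj z *: (v *m w^T).
  by rewrite -mulmxA -{1}symB -trmx_mul wB linearZ /= -scalemxAr.
have zr : cj z = z.
  apply/eqP; rewrite -subr_eq0; move: e1; rewrite vB -scalemxAl => /eqP.
  rewrite eq_sym -subr_eq0 -scalerBl scalemx_eq0 => /orP[//|/eqP vw0].
  case/negP: v0; apply/eqP/matrixP => i j; rewrite ord1 [RHS]mxE.
  move/matrixP/(_ 0 0): vw0; rewrite !mxE => /eqP.
  rewrite psumr_eq0 => [/allP/(_ j)|k _]; last first.
    by rewrite !mxE /cj -normCK exprn_ge0.
  rewrite mem_index_enum => /(_ isT) /=.
  by rewrite !mxE /cj -normCK expf_eq0 /= normr_eq0 => /eqP.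
have zE : z = toC (complex.Re z).
  case: (z) zr => a b [] /eqP; rewrite eqNr => /eqP -> //.
exists (complex.Re z); rewrite -(eigenvalue_map toC).
exact: (eq_ind z (eigenvalue B) Bz _ zE).
Qed.

Lemma adjmx_smallest_eigenvalue_exists (R : rcfType) (n : nat) (e : rel 'I_n) :
  (0 < n)%N -> symmetric e ->
  exists l : R, is_smallest_eigenvalue (adjmx R e) l.
Proof.
move=> n0 sym_e; set A := adjmx R e.
have symA : A^T = A by apply/matrixP => i j; rewrite !mxE sym_e.
have [a Aa] := symmetric_eigenvalue_exists n0 symA.
have p0 : char_poly A != 0 by rewrite monic_neq0 ?char_poly_monic.
have rE x : eigenvalue A x = (x \in rootsR (char_poly A)).
  by rewrite eigenvalue_root_char -(roots_on_rootsR p0) in_itv.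
have [i _ Mi] := @arg_minP _ _ _ (SeqSub (etrans (esym (rE a)) Aa)) predT val isT.
exists (val i); split; first by rewrite rE (valP i).
by move=> b; rewrite rE => Hb; apply: (Mi (SeqSub Hb)).
Qed.

(* Main.v *)
Require Import Defs.
From mathcomp Require Import all_boot all_order all_algebra.
From mathcomp Require Import fingroup perm reals ring lra zify.

Set Implicit Arguments.
Unset Strict Implicit.
Unset Printing Implicit Defensive.

Import Order.TTheory GRing.Theory Num.Theory.

Local Open Scope ring_scope.

(** All three bounds have the form c <= lambda1, and each follows from an
    inequality c |x|^2 <= x A x^T valid for every vector x, read at an
    eigenvector ([eigenvalue_ge_qform]).

    For the first bound, let p be a vertex of largest degree D and let d be the
    second largest degree; if there is an edge, then 1 <= d <= D. A symmetric
    nonnegative matrix A satisfies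
    |x A x^T| <= rho |x|^2 as soon as A w <= rho w for some positive vector w
    ([schur_test]). For an adjacency matrix take w = sqrt (D / d) at p and 1
    elsewhere: this gives rho = sqrt (D d) ([adjmx_qform_le]).

    For the third bound, the complement has adjacency matrix
    A' = J - I - A, with J the all-ones matrix, so
    x A x^T = (sum of x)^2 - |x|^2 - x A' x^T >= - |x|^2 - x A' x^T.
    The last term is controlled by [adjmx_qform_le] for the complement, whose
    two largest degrees come from the two smallest degrees of the graph.

    For the second bound, an entry of A is 0 or 1, so each term A_ij x_i x_j is
    at least min (0, x_i x_j), hence at least
    x_i x_j / 2 - (x_i^2 + x_j^2) / 4; the sum of the latter over all i, j is
    (sum of x)^2 / 2 - n |x|^2 / 2 ([adjmx_qform_ge]). *)

(** * Quadratic forms and eigenvalues *)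

Definition qform (R : pzSemiRingType) (n : nat) (A : 'M[R]_n) (x : 'rV[R]_n) : R :=
  (x *m A *m x^T) 0 0.

Lemma qformE (R : comPzSemiRingType) (n : nat) (A : 'M[R]_n) (x : 'rV[R]_n) :
  qform A x = \sum_i \sum_j A i j * (x 0 i * x 0 j).
Proof.
rewrite /qform mxE exchange_big; apply: eq_bigr => j _ /=.
rewrite !mxE mulr_suml; apply: eq_bigr => i _.
by rewrite mulrCA mulrA.
Qed.

Lemma qform1 (R : pzSemiRingType) (n : nat) (x : 'rV[R]_n) :
  qform 1%:M x = \sum_i x 0 i ^+ 2.
Proof.
by rewrite /qform mulmx1 mxE; apply: eq_bigr => i _; rewrite mxE expr2.
Qed.

Lemma qform_const1 (R : pzSemiRingType) (n : nat) (x : 'rV[R]_n) :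
  qform (const_mx 1) x = (\sum_i x 0 i) ^+ 2.
Proof.
rewrite /qform mxE expr2 mulr_sumr; apply: eq_bigr => j _.
rewrite !mxE; congr (_ * _).
by apply: eq_bigr => i _; rewrite mxE mulr1.
Qed.

Lemma qformB (R : pzRingType) (n : nat) (A B : 'M[R]_n) (x : 'rV[R]_n) :
  qform (A - B) x = qform A x - qform B x.
Proof. by rewrite /qform mulmxBr mulmxBl !mxE. Qed.

Lemma qform1_gt0 (R : realFieldType) (n : nat) (x : 'rV[R]_n) :
  x != 0 -> 0 < qform 1%:M x.
Proof.
move=> x0; rewrite qform1 lt0r sumr_ge0 => [|i _]; last exact: sqr_ge0.
rewrite andbT; apply: contra x0; rewrite psumr_eq0 => [/allP H|i _]; last exact: sqr_ge0.
apply/eqP/rowP => i; rewrite mxE; apply/eqP.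
by have := H i (mem_index_enum i); rewrite /= sqrf_eq0.
Qed.

(** At an eigenvector v the form equals l |v|^2, and |v|^2 > 0. *)
Lemma eigenvalue_ge_qform (R : realFieldType) (n : nat) (A : 'M[R]_n) (c l : R) :
  (forall x : 'rV[R]_n, c * qform 1%:M x <= qform A x) ->
  eigenvalue A l -> c <= l.
Proof.
move=> cA /eigenvalueP[v vA v0]; have := cA v.
have -> : qform A v = l * qform 1%:M v by rewrite /qform vA mulmx1 -scalemxAl mxE.
by rewrite ler_pM2r // qform1_gt0.
Qed.

(** Weighted arithmetic-geometric mean: 2 |x_i x_j| is at most
    x_i^2 w_j / w_i + x_j^2 w_i / w_j. After summation against the symmetric
    matrix A the two halves are equal, and the coefficient of x_i^2 becomes
    (A w)_i / w_i. *)
Lemma schur_test (R : realFieldType) (n : nat) (A : 'M[R]_n) (w : 'I_n -> R)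
    (rho : R) (x : 'rV[R]_n) :
  A^T = A -> (forall i j, 0 <= A i j) -> (forall i, 0 < w i) ->
  (forall i, \sum_j A i j * w j <= rho * w i) ->
  `|qform A x| <= rho * qform 1%:M x.
Proof.
move=> symA A0 w0 Aw; pose c i j := A i j * w j * (x 0 i ^+ 2 / w i).
have AC i j : A i j = A j i by rewrite -{1}symA mxE.
have amgm i j : `|A i j * (x 0 i * x 0 j)| <= (c i j + c j i) / 2.
  rewrite /c (AC j i) -!(mulrA (A i j)) -mulrDr -mulrA.
  rewrite normrM (ger0_norm (A0 i j)) ler_wpM2l //.
  have [wi wj] := (w0 i, w0 j).
  have wi' : w i != 0 by rewrite gt_eqF.
  have wj' : w j != 0 by rewrite gt_eqF.
  rewrite normrM -(real_normK (num_real (x 0 i))) -(real_normK (num_real (x 0 j))).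
  set a := `|x 0 i|; set b := `|x 0 j|; rewrite -subr_ge0.
  have -> : (w j * (a ^+ 2 / w i) + w i * (b ^+ 2 / w j)) / 2 - a * b
          = (w j * a - w i * b) ^+ 2 / (2 * w i * w j) by field; rewrite wi' wj'.
  by rewrite divr_ge0 ?sqr_ge0 // !mulr_ge0 // ltW.
rewrite qformE; apply: (le_trans (ler_norm_sum _ _ _)).
apply: (@le_trans _ _ (\sum_i \sum_j (c i j + c j i) / 2)).
  apply: ler_sum => i _; apply: (le_trans (ler_norm_sum _ _ _)).
  by apply: ler_sum => j _.
have -> : \sum_i \sum_j (c i j + c j i) / 2 = \sum_i \sum_j c i j.
  transitivity ((\sum_i \sum_j c i j + \sum_i \sum_j c j i) / 2).
    rewrite -big_split mulr_suml; apply: eq_bigr => i _ /=.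
    by rewrite -big_split mulr_suml.
  by rewrite [X in _ + X]exchange_big /=; field.
rewrite qform1 mulr_sumr; apply: ler_sum => i _.
rewrite /c -mulr_suml.
apply: (le_trans (ler_wpM2r _ (Aw i))); first by rewrite divr_ge0 ?sqr_ge0 ?ltW.
by rewrite le_eqVlt; apply/orP; left; apply/eqP; field; rewrite gt_eqF.
Qed.

(** * Quadratic form of an adjacency matrix *)

Lemma degree_sum (R : pzSemiRingType) (n : nat) (e : rel 'I_n) (i : 'I_n) :
  (degree e i)%:R = \sum_j (e i j)%:R :> R.
Proof.
rewrite /degree cardsE -sum1_card natr_sum big_mkcond /=.
by apply: eq_bigr => j _; rewrite unfold_in; case: (e i j).
Qed.

(** Schur test with weight r = sqrt (D / d) at p and 1 elsewhere. The row of p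
    has weighted sum at most D = sqrt (D d) * r, because there is no loop at p.
    A row i != p has weighted sum at most d when i is not adjacent to p, and
    d - 1 + r otherwise; the latter is at most r d = sqrt (D d) because
    (d - 1) (r - 1) >= 0. The weight needs d > 0, which holds once there is an
    edge: one of its ends differs from p. The bounds D and d are elements of R
    so that the lemma applies to the expressions n - 1 - degree without
    truncated subtraction. *)
Lemma adjmx_qform_le (R : rcfType) (n : nat) (e : rel 'I_n) (p : 'I_n)
    (D d : R) (x : 'rV[R]_n) :
  symmetric e -> irreflexive e -> d <= D -> (degree e p)%:R <= D ->
  (forall i, i != p -> (degree e i)%:R <= d) ->
  `|qform (adjmx R e) x| <= Num.sqrt (D * d) * qform 1%:M x.
Proof.
move=> e_sym e_irr dD pD degd.
case: (boolP [exists i, exists j, e i j]) => [/existsP[i /existsP[j eij]]|noe].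
- have degE k l : e k l -> 1 <= (degree e k)%:R :> R.
    by move=> ekl; rewrite ler1n; apply/card_gt0P; exists l; rewrite inE.
  have d1 : 1 <= d.
    have [ip|ip] := eqVneq i p; last exact: le_trans (degE _ _ eij) (degd _ ip).
    have jp : j != p by apply/eqP => jp; rewrite ip jp e_irr in eij.
    by apply: le_trans (degd _ jp); apply: (degE j i); rewrite e_sym.
  have d0 : 0 < d by apply: lt_le_trans d1.
  have D0 : 0 < D by apply: lt_le_trans dD.
  pose r := Num.sqrt (D / d).
  have r1 : 1 <= r by rewrite -[1]sqrtr1 ler_wsqrtr // ler_pdivlMr // mul1r.
  have rd : Num.sqrt (D * d) = r * d.
    rewrite -[X in r * X]gtr0_norm // -sqrtr_sqr -sqrtrM; last by rewrite divr_ge0 ?ltW.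
    by congr Num.sqrt; field; rewrite gt_eqF.
  have rrd : r * d * r = D.
    by rewrite mulrAC -expr2 sqr_sqrtr ?divr_ge0 ?ltW // divfK // gt_eqF.
  apply: (@schur_test _ _ _ (fun i => if i == p then r else 1)).
  + by apply/matrixP => k l; rewrite !mxE e_sym.
  + by move=> k l; rewrite mxE ler0n.
  + by move=> k; case: ifP => _ //; apply: lt_le_trans r1.
  move=> k; rewrite rd.
  have -> : \sum_l adjmx R e k l * (if l == p then r else 1)
          = (degree e k)%:R + (e k p)%:R * (r - 1).
    rewrite degree_sum (bigD1 p) //= [in RHS](bigD1 p) //= mxE eqxx.
    rewrite (eq_bigr (fun l => (e k l)%:R)) => [|l /negbTE ->].
      by ring.
    by rewrite mxE mulr1.
  have [->|kp] := eqVneq k p; first by rewrite e_irr mul0r addr0 rrd.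
  have : 0 <= (d - 1) * (r - 1) by rewrite mulr_ge0 ?subr_ge0.
  have : d <= r * d by exact: ler_peMl (ltW d0) r1.
  have := degd _ kp; case: (e k p); rewrite ?mul0r ?mul1r; lra.
- have -> : adjmx R e = 0.
    apply/matrixP => i j; rewrite !mxE.
    case eij: (e i j) => //; case/negP: noe.
    by apply/existsP; exists i; apply/existsP; exists j.
  rewrite [qform 0 x]/qform mulmx0 mul0mx mxE normr0 mulr_ge0 ?sqrtr_ge0 //.
  by rewrite qform1 sumr_ge0 // => i _; rewrite sqr_ge0.
Qed.

(** The termwise bound is (x_i - x_j)^2 >= 0 when A_ij = 0, and
    (x_i + x_j)^2 >= 0 when A_ij = 1. *)
Lemma adjmx_qform_ge (R : realFieldType) (n : nat) (e : rel 'I_n) (x : 'rV[R]_n) :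
  - (n%:R / 2) * qform 1%:M x <= qform (adjmx R e) x.
Proof.
have pointwise i j : (x 0 i * x 0 j) / 2 - (x 0 i ^+ 2 + x 0 j ^+ 2) / 4
    <= adjmx R e i j * (x 0 i * x 0 j).
  rewrite mxE; move: (x 0 i) (x 0 j) => a b.
  have := sqr_ge0 (a + b); have := sqr_ge0 (a - b).
  by case: (e i j); rewrite ?mul0r ?mul1r; lra.
pose S := \sum_i x 0 i.
have sumE : \sum_i \sum_j ((x 0 i * x 0 j) / 2 - (x 0 i ^+ 2 + x 0 j ^+ 2) / 4)
    = S ^+ 2 / 2 - n%:R / 2 * qform 1%:M x.
  transitivity (\sum_i (x 0 i * S / 2 - (x 0 i ^+ 2 * n%:R + qform 1%:M x) / 4)).
    apply: eq_bigr => i _; rewrite sumrB -!mulr_suml -mulr_sumr big_split /=.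
    by rewrite sumr_const card_ord qform1 mulr_natr.
  rewrite sumrB -!mulr_suml big_split /= -mulr_suml sumr_const card_ord.
  rewrite -qform1 -/S -[_ *+ n]mulr_natr.
  by field.
apply: (@le_trans _ _ (S ^+ 2 / 2 - n%:R / 2 * qform 1%:M x)).
  by have := sqr_ge0 S; lra.
rewrite -sumE qformE; apply: ler_sum => i _.
by apply: ler_sum => j _; exact: pointwise.
Qed.

(** * Complement graph *)

Definition compl_rel (n : nat) (e : rel 'I_n) : rel 'I_n :=
  fun i j => (i != j) && ~~ e i j.

Lemma adjmx_compl (R : pzRingType) (n : nat) (e : rel 'I_n) :
  irreflexive e -> adjmx R (compl_rel e) = const_mx 1 - 1%:M - adjmx R e.
Proof.
move=> e_irr; apply/matrixP => i j; rewrite !mxE /compl_rel.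
have [->|_] := eqVneq i j; first by rewrite e_irr /= subrr subr0.
by case: (e i j); rewrite /= subr0 ?subrr ?subr0.
Qed.

Lemma degree_compl (R : pzRingType) (n : nat) (e : rel 'I_n) (i : 'I_n) :
  irreflexive e -> (degree (compl_rel e) i)%:R = n%:R - 1 - (degree e i)%:R :> R.
Proof.
move=> e_irr; rewrite !degree_sum.
transitivity (\sum_j adjmx R (compl_rel e) i j).
  by apply: eq_bigr => j _; rewrite mxE.
rewrite adjmx_compl //.
have -> : n%:R - 1 = \sum_j (1 - (i == j)%:R) :> R.
  rewrite sumrB sumr_const card_ord (bigD1 i) //= eqxx big1 ?addr0 // => j.
  by rewrite eq_sym => /negbTE ->.
by rewrite -sumrB; apply: eq_bigr => j _; rewrite !mxE.
Qed.

(** * Ranking the vertices by degree *)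

(** Distinct vertices occupy distinct positions of the sorted degree list, even
    when degrees coincide; this is what turns the second largest degree, counted
    with multiplicity, into a bound on all vertices but one. *)
Lemma degree_seq_rank (n : nat) (e : rel 'I_n) :
  exists s : 'S_n, forall i, nth 0%N (degree_seq e) (s i) = degree e i.
Proof.
have sz : size (degree_seq e) == n by rewrite size_sort size_map size_enum_ord.
have : perm_eq [seq degree e i | i <- enum 'I_n] (Tuple sz).
  by rewrite /= perm_sym perm_sort.
case/tuple_permP => s /eq_in_map sE; exists s => i.
by rewrite [RHS]sE ?mem_enum // (tnth_nth 0%N).
Qed.

Lemma degree_seq_noninc (n : nat) (e : rel 'I_n) (i j : nat) :
  (i <= j < n)%N -> (nth 0%N (degree_seq e) j <= nth 0%N (degree_seq e) i)%N.
Proof.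
move=> /andP[ij jn]; have sz : size (degree_seq e) = n.
  by rewrite size_sort size_map size_enum_ord.
have geq_trans : transitive geq by move=> a b c /= ba cb; exact: leq_trans cb ba.
have sorted_ds : sorted geq (degree_seq e).
  by apply: sort_sorted => a b; exact: leq_total.
have i_in : i \in [pred k | (k < size (degree_seq e))%N].
  by rewrite inE sz (leq_ltn_trans ij).
by apply: (sorted_leq_nth geq_trans leqnn 0%N sorted_ds) => //; rewrite inE sz.
Qed.

Theorem mainTheorem4 (R : realType) (n : nat) (hn : (2 <= n)%N)
    (e : rel 'I_n) (e_sym : symmetric e) (e_irr : irreflexive e)
    (lambda1 : R) (hlambda1 : is_smallest_eigenvalue (adjmx R e) lambda1) :
  [/\ - Num.sqrt ((max_degree e)%:R * (max_degree2 e)%:R) <= lambda1,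
      - (n%:R / 2) <= lambda1
    & - 1 - Num.sqrt ((n%:R - 1 - (min_degree e)%:R)
                      * (n%:R - 1 - (min_degree2 e)%:R)) <= lambda1].
Proof.
case: hlambda1 => eigl _; have [s sE] := degree_seq_rank e.
have n0 : (0 < n)%N by apply: ltnW.
have nlast : (n - 1 < n)%N by rewrite ltn_subrL.
have rankE k (kn : (k < n)%N) i : (i == s^-1%g (Ordinal kn)) = (s i == k :> nat).
  by rewrite -(inj_eq (@perm_inj _ s)) permKV.
split; apply: eigenvalue_ge_qform eigl => x.
- (* p is the vertex ranked first; any other rank is at least 1. *)
  pose p := s^-1%g (Ordinal n0).
  suff : `|qform (adjmx R e) x| <=
      Num.sqrt ((max_degree e)%:R * (max_degree2 e)%:R) * qform 1%:M x.
    by rewrite ler_norml mulNr => /andP[].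
  apply: (@adjmx_qform_le _ _ _ p) => // [||i].
  + by rewrite ler_nat degree_seq_noninc.
  + by rewrite -sE permKV.
  + rewrite rankE -lt0n => si; rewrite ler_nat -sE degree_seq_noninc //.
    by rewrite si ltn_ord.
- exact: adjmx_qform_ge.
(* p is the vertex ranked last; any other rank is at most n - 2. *)
pose p := s^-1%g (Ordinal nlast).
have : `|qform (adjmx R (compl_rel e)) x| <=
    Num.sqrt ((n%:R - 1 - (min_degree e)%:R)
              * (n%:R - 1 - (min_degree2 e)%:R)) * qform 1%:M x.
  apply: (@adjmx_qform_le _ _ _ p) => [i j|i|||i].
  + by rewrite /compl_rel eq_sym e_sym.
  + by rewrite /compl_rel eqxx.
  + by rewrite lerB // ler_nat degree_seq_noninc // nlast leq_sub2l.
  + by rewrite degree_compl // -sE permKV.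
  + rewrite rankE degree_compl // => si; rewrite lerB // ler_nat -sE degree_seq_noninc //.
    have := ltn_ord (s i); have : (s i : nat) != (n - 1)%N by [].
    by lia.
rewrite adjmx_compl // !qformB qform_const1 ler_norml => /andP[_].
have := sqr_ge0 (\sum_i x 0 i); lra.
Qed.
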